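(* Let $\mathbf a_1,\dots,\mathbf a_m\in\mathbb R^3$ and $t_1,\dots,t_m\in\mathbb R$ be such that there exist $\mathbf x_0\in\mathbb R^3$ and $t_0\in\mathbb R$ with $\lVert \mathbf a_i-\mathbf x_0\rVert = t_i-t_0$ for all $i=1,\dots,m$. Consider the system of equations $$\lVert \mathbf a_i-\mathbf x\rVert = |t_i-t|\qquad (i=1,\dots,m)\tag{S}$$ in the unknowns $t\in\mathbb R$, $\mathbf x\in\mathbb R^3$. With the matrices $A$, $B$, $\tilde A$, $\tilde B$ and the quantities $\mathbf u,\mathbf v,\alpha,\beta$ defined in the context, the following hold. (a) If $A$ has rank $5$, then (S) has a unique solution, given by $$\begin{pmatrix} t\\ \mathbf x\end{pmatrix} = B\cdot\begin{pmatrix}\lVert\mathbf a_1\rVert^2-t_1^2\\ \vdots\\ \lVert\mathbf a_m\rVert^2-t_m^2\end{pmatrix}.$$ (b) Assume that $\operatorname{rank}(A)\le 4$ and that $\mathbf a_1,\dots,\mathbf a_m$ are not coplanar (so in particular $m\ge 4$). Then (S) is satisfied by the same pairs $(t,\mathbf x)\in\mathbb R\times\mathbb R^3$ as the system $$\mathbf x = t\,\mathbf u+\mathbf v\quad\text{and}\quad \bigl(\lVert\mathbf u\rVert^2-1\bigr)t^2+\bigl(2\mathbf u^T\mathbf v-\alpha\bigr)t+\lVert\mathbf v\rVert^2-\beta=0.\tag{Q}$$ (c) Moreover, under the assumptions of (b), the coefficients $\lVert\mathbf u\rVert^2-1$ of $t^2$ and $2\mathbf u^T\mathbf v-\alpha$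 of $t$ in the quadratic equation in (Q) are not both zero, so (Q) has one or two solutions.
   Context: $\lVert\cdot\rVert$ is the Euclidean norm on $\mathbb R^3$; vectors are column vectors. (Interpretation: a signal emitted at position $\mathbf x_0$ at time $t_0$ and traveling with speed $1$ is received at time $t_i$ by a sensor at position $\mathbf a_i$.) Define $$A:=\begin{pmatrix}-2t_1&2\mathbf a_1^T&-1\\ \vdots&\vdots&\vdots\\ -2t_m&2\mathbf a_m^T&-1\end{pmatrix}\in\mathbb R^{m\times 5},\qquad \tilde A:=\begin{pmatrix}2\mathbf a_1^T&-1\\ \vdots&\vdots\\ 2\mathbf a_m^T&-1\end{pmatrix}\in\mathbb R^{m\times 4}.$$ If $A$ has rank $5$, let $B\in\mathbb R^{4\times m}$ be the matrix obtained by deleting the last row of $(A^TA)^{-1}A^T\in\mathbb R^{5\times m}$. The points $\mathbf a_1,\dots,\mathbf a_m$ are not coplanar (i.e. not contained in a common affine plane of $\mathbb R^3$) if and only if $\tilde A$ has rank $4$. In that case define $\tilde B:=(\tilde A^T\tilde A)^{-1}\tilde A^T\in\mathbb R^{4\times m}$, and define $\mathbf u,\mathbf v\in\mathbb R^3$ and $\alpha,\beta\in\mathbb R$ by $$\begin{pmatrix}\mathbf u\\ \alpha\end{pmatrix}:=2\tilde B\begin{pmatrix}t_1\\ \vdots\\ t_m\end{pmatrix},\qquad \begin{pmatrix}\mathbf v\\ \beta\end{pmatrix}:=\tilde B\begin{pmatrix}\lVert\mathbf a_1\rVert^2-t_1^2\\ \vdots\\ \lVert\mathbf a_m\rVert^2-t_m^2\end{pmatrix}.$$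 *)

(* Defs.v *)
From mathcomp Require Import all_boot all_order all_algebra.
From mathcomp Require Import classical_sets functions cardinality reals.

Set Implicit Arguments.
Unset Strict Implicit.
Unset Printing Implicit Defensive.

Import GRing.Theory Num.Theory.
Local Open Scope ring_scope.

Definition dot (R : realType) (n : nat) (x y : 'cV[R]_n) : R :=
  (x^T *m y) 0 0.

(* The norm MathComp-Analysis puts on matrices is the sup norm, hence an
   explicit Euclidean norm. *)
Definition enorm (R : realType) (n : nat) (x : 'cV[R]_n) : R :=
  Num.sqrt (\sum_(i < n) x i 0 ^+ 2).

(* [nu] is a normal vector of the common affine plane
   {x | dot nu x = c}. *)
Definition coplanar (R : realType) (m : nat) (a : 'I_m -> 'cV[R]_3) : Prop :=
  exists (nu : 'cV[R]_3) (c : R), nu != 0 /\ forall i, dot nu (a i) = c.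

Definition matA (R : realType) (m : nat) (a : 'I_m -> 'cV[R]_3)
    (t : 'I_m -> R) : 'M[R]_(m, 5) :=
  \matrix_(i < m)
    row_mx (- 2 * t i)%:M (row_mx (2 *: (a i)^T) (- 1)%:M : 'rV[R]_(3 + 1)).

Definition matAt (R : realType) (m : nat) (a : 'I_m -> 'cV[R]_3) :
    'M[R]_(m, 4) :=
  \matrix_(i < m) (row_mx (2 *: (a i)^T) (- 1)%:M : 'rV[R]_(3 + 1)).

(* [invmx M] is [M] itself if [M] is singular: [matB] is the intended matrix
   only if [matA] has rank 5, and [matBt] only if [matAt] has rank 4. *)
Definition matB (R : realType) (m : nat) (a : 'I_m -> 'cV[R]_3)
    (t : 'I_m -> R) : 'M[R]_(4, m) :=
  row' ord_max (invmx ((matA a t)^T *m matA a t) *m (matA a t)^T).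

Definition matBt (R : realType) (m : nat) (a : 'I_m -> 'cV[R]_3) :
    'M[R]_(4, m) :=
  invmx ((matAt a)^T *m matAt a) *m (matAt a)^T.

Definition sqdiff (R : realType) (m : nat) (a : 'I_m -> 'cV[R]_3)
    (t : 'I_m -> R) : 'cV[R]_m :=
  \col_(i < m) (enorm (a i) ^+ 2 - t i ^+ 2).

Definition u_alpha (R : realType) (m : nat) (a : 'I_m -> 'cV[R]_3)
    (t : 'I_m -> R) : 'cV[R]_(3 + 1) :=
  2 *: (matBt a *m (\col_(i < m) t i)).

Definition v_beta (R : realType) (m : nat) (a : 'I_m -> 'cV[R]_3)
    (t : 'I_m -> R) : 'cV[R]_(3 + 1) :=
  matBt a *m sqdiff a t.

Definition vecu (R : realType) (m : nat) (a : 'I_m -> 'cV[R]_3)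
  (t : 'I_m -> R) : 'cV[R]_3 := usubmx (u_alpha a t).

Definition alpha (R : realType) (m : nat) (a : 'I_m -> 'cV[R]_3)
  (t : 'I_m -> R) : R := dsubmx (u_alpha a t) 0 0.

Definition vecv (R : realType) (m : nat) (a : 'I_m -> 'cV[R]_3)
  (t : 'I_m -> R) : 'cV[R]_3 := usubmx (v_beta a t).

Definition beta (R : realType) (m : nat) (a : 'I_m -> 'cV[R]_3)
  (t : 'I_m -> R) : R := dsubmx (v_beta a t) 0 0.

(* In [systemS] and [systemQ] the pair of unknowns is (time, position). *)
Definition systemS (R : realType) (m : nat) (a : 'I_m -> 'cV[R]_3)
    (t : 'I_m -> R) (p : R * 'cV[R]_3) : Prop :=
  forall i, enorm (a i - p.2) = `|t i - p.1|.

Definition quad_coef (R : realType) (m : nat) (a : 'I_m -> 'cV[R]_3)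
    (t : 'I_m -> R) : R :=
  enorm (vecu a t) ^+ 2 - 1.

Definition lin_coef (R : realType) (m : nat) (a : 'I_m -> 'cV[R]_3)
    (t : 'I_m -> R) : R :=
  2 * dot (vecu a t) (vecv a t) - alpha a t.

Definition systemQ (R : realType) (m : nat) (a : 'I_m -> 'cV[R]_3)
    (t : 'I_m -> R) (p : R * 'cV[R]_3) : Prop :=
  p.2 = p.1 *: vecu a t + vecv a t /\
  quad_coef a t * p.1 ^+ 2 + lin_coef a t * p.1
    + enorm (vecv a t) ^+ 2 - beta a t = 0.

(* Main.v *)
(* Squaring the equations of (S) and putting [s = |x|^2 - t^2] makes them linear
   in [(t, x, s)], with matrix [A]; so rank 5 determines the solution.  If
   [rank A <= 4 = rank At], then [A] and [At] have the same column space, which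
   contains [2 tau] and, thanks to the known solution, the right-hand side.
   Hence [At] applied to [(u, alpha)] and [(v, beta)] gives exactly these two
   vectors, and the linear system is equivalent to
   [(x, s) = t (u, alpha) + (v, beta)]; the definition of [s] then becomes the
   quadratic equation of (Q). *)

Require Import Defs.
From mathcomp Require Import all_boot all_order all_algebra finmap ring lra.
From mathcomp Require Import classical_sets functions cardinality reals.

Set Implicit Arguments.
Unset Strict Implicit.

Import GRing.Theory Num.Theory.

Local Open Scope ring_scope.
Local Open Scope card_scope.
Local Open Scope classical_set_scope.

(** * Inner product and Euclidean norm *)

Section Dot.
Variables (R : realType) (n : nat).
Implicit Types x y z : 'cV[R]_n.

Lemma dotE x y : dot x y = \sum_i x i 0 * y i 0.
Proof. by rewrite /dot mxE; apply: eq_bigr => i _; rewrite mxE. Qed.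

Lemma dotC x y : dot x y = dot y x.
Proof. by rewrite !dotE; apply: eq_bigr => i _; rewrite mulrC. Qed.

Lemma dotDl x y z : dot (x + y) z = dot x z + dot y z.
Proof. by rewrite /dot linearD mulmxDl mxE. Qed.

Lemma dotZl k x y : dot (k *: x) y = k * dot x y.
Proof. by rewrite /dot linearZ -scalemxAl mxE. Qed.

Lemma dotBl x y z : dot (x - y) z = dot x z - dot y z.
Proof. by rewrite -scaleN1r dotDl dotZl mulN1r. Qed.

Lemma dotDr x y z : dot x (y + z) = dot x y + dot x z.
Proof. by rewrite dotC dotDl !(dotC x). Qed.

Lemma dotZr k x y : dot x (k *: y) = k * dot x y.
Proof. by rewrite dotC dotZl dotC. Qed.

Lemma dotBr x y z : dot x (y - z) = dot x y - dot x z.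
Proof. by rewrite dotC dotBl !(dotC x). Qed.

Lemma dot_eq0 x : dot x x = 0 -> x = 0.
Proof.
rewrite dotE => /eqP; rewrite psumr_eq0 => [/allP x0|i _]; last exact: sqr_ge0.
apply/colP => i; have := x0 i; rewrite mem_index_enum mxE => /(_ isT).
by rewrite mulf_eq0 orbb => /eqP.
Qed.

Lemma sqr_enorm x : enorm x ^+ 2 = dot x x.
Proof. by rewrite sqr_sqrtr ?dotE // sumr_ge0 // => i _; exact: sqr_ge0. Qed.

Lemma enorm_ge0 x : 0 <= enorm x.
Proof. exact: sqrtr_ge0. Qed.

Lemma enorm_eq_norm x (r : R) : enorm x = `|r| <-> dot x x = r ^+ 2.
Proof.
rewrite -sqr_enorm -[r ^+ 2]real_normK ?num_real //; split => [-> //|/eqP].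
by rewrite eqrXn2 ?enorm_ge0 ?normr_ge0 // => /eqP.
Qed.

(** Under these hypotheses the squared norm of [x - dot y x *: y] expands to
    [dot x x - dot y x ^+ 2 = 0]. *)
Lemma cauchy_schwarz_eq x y :
  dot y y = 1 -> dot x x = dot y x ^+ 2 -> x = dot y x *: y.
Proof.
move=> y1 xx; apply/subr0_eq/dot_eq0.
rewrite dotBl !dotBr !dotZl !dotZr y1 xx (dotC x y); ring.
Qed.

End Dot.

(** * Left inverses of matrices of full column rank *)

Section LeastSquares.
Variables (R : realType) (m n : nat) (M : 'M[R]_(m, n)).

(** Common form of [matBt] and of [matB] before its last row is deleted; the Moore-Penrose inverse
    when [M] has full column rank. *)
Definition lsq_inv : 'M[R]_(n, m) := invmx (M^T *m M) *m M^T.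

Hypothesis rkM : \rank M = n.

(** If [v *m (M^T *m M) = 0], then the squared norm of [M *m v^T] is 0, and full column rank forces
    [v = 0]. *)
Lemma gram_unit : M^T *m M \in unitmx.
Proof.
have fM : row_free M^T by rewrite /row_free mxrank_tr rkM.
rewrite -row_free_unit -kermx_eq0; apply/rowV0P => v /sub_kermxP.
rewrite mulmxA => vM0; apply/eqP; rewrite -(mulmx_free_eq0 v fM).
rewrite -trmx_eq0; apply/eqP/dot_eq0.
by rewrite /dot trmxK trmx_mul trmxK mulmxA vM0 mul0mx mxE.
Qed.

Lemma lsq_invK k (z : 'M_(n, k)) : lsq_inv *m (M *m z) = z.
Proof. by rewrite /lsq_inv -!mulmxA (mulmxA M^T) mulKmx ?gram_unit. Qed.

End LeastSquares.

(** * Linearization of (S) and its equivalence with (Q) *)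

Section Linearization.
Variables (R : realType) (m : nat) (a : 'I_m -> 'cV[R]_3) (t : 'I_m -> R).

Let tau : 'cV[R]_m := \col_i t i.

Definition lift_pos (p : R * 'cV[R]_3) : 'cV[R]_(3 + 1) :=
  col_mx p.2 (dot p.2 p.2 - p.1 ^+ 2)%:M.

Lemma matA_row_mx : matA a t = row_mx (- 2 *: tau) (matAt a) :> 'M_(m, 1 + 4).
Proof.
apply/row_matrixP => i; rewrite row_row_mx !rowK; congr row_mx.
by apply/rowP => j; rewrite !mxE ord1 eqxx mulr1n.
Qed.

Lemma matAtE (x : 'cV[R]_3) (s : R) i :
  (matAt a *m col_mx x s%:M) i 0 = 2 * dot (a i) x - s.
Proof.
have -> : (matAt a *m col_mx x s%:M) i 0 =
    (row i (matAt a) *m col_mx x s%:M) 0 0 by rewrite -row_mul [RHS]mxE.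
rewrite rowK (@mul_row_col _ 1 3 1) -scalemxAl -scalar_mxM !mxE eqxx mulr1n mulN1r.
by rewrite dotE; congr (2 * _ - _); apply: eq_bigr => j _; rewrite mxE.
Qed.

(** Both sides of each equation of (S) are nonnegative, so squaring loses nothing. *)
Lemma systemS_matAt p : systemS a t p <->
  matAt a *m lift_pos p = sqdiff a t + p.1 *: (2 *: tau).
Proof.
split => [S|E i].
  apply/colP => i; move/enorm_eq_norm: (S i).
  by rewrite matAtE !mxE sqr_enorm dotBl !dotBr (dotC p.2); lra.
apply/enorm_eq_norm; move/colP/(_ i): E.
by rewrite matAtE !mxE sqr_enorm dotBl !dotBr (dotC p.2); lra.
Qed.

Lemma systemS_matA p : systemS a t p <->
  matA a t *m (col_mx p.1%:M (lift_pos p) : 'cV_(1 + 4)) = sqdiff a t.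
Proof.
have -> : matA a t *m (col_mx p.1%:M (lift_pos p) : 'cV_(1 + 4)) =
    matAt a *m lift_pos p - p.1 *: (2 *: tau).
  by rewrite matA_row_mx (@mul_row_col _ _ 1 4) mul_mx_scalar addrC scaleNr scalerN.
rewrite systemS_matAt; split => [->|/eqP]; first by rewrite addrK.
by rewrite subr_eq => /eqP.
Qed.

(** The left inverse of [matA] recovers [(t, x, s)]; deleting its last row drops the auxiliary
    unknown [s]. *)
Lemma matB_mul (p : R * 'cV[R]_3) :
  \rank (matA a t) = 5%N -> systemS a t p ->
  (col_mx p.1%:M p.2 : 'cV[R]_(1 + 3)) = matB a t *m sqdiff a t.
Proof.
move=> rk /systemS_matA <-.
have -> (z : 'cV_5) : matB a t *m (matA a t *m z) =
    row' ord_max (lsq_inv (matA a t) *m (matA a t *m z)).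
  by apply/colP => i; rewrite !mxE; apply: eq_bigr => j _; rewrite mxE.
rewrite lsq_invK //; apply/colP => i; rewrite [RHS]mxE.
case: (split_ordP i) => j ->.
  (* [lift ord_max] keeps the value of an index, so only the block decompositions [1 + 3] and
     [1 + (3 + 1)] have to be matched. *)
  have -> : lift ord_max (lshift 3 j) = lshift 4 j.
    by apply: val_inj; rewrite /= /bump ord1.
  by rewrite !(@col_mxEu _ 1).
have -> : lift ord_max (rshift 1 j) = rshift 1 (lshift 1 j).
  by apply: val_inj; rewrite /= /bump leqNgt ltnS ltn_ord.
by rewrite !(@col_mxEd _ 1) (@col_mxEu _ 3).
Qed.

(** A nonzero kernel vector [(x, s)] gives [2 * dot x (a i) = s] for all [i], a plane with normal
    [x] provided that [x != 0]. *)
Lemma matAt_rank : ~ coplanar a -> \rank (matAt a) = 4%N.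
Proof.
move=> ncop; apply/eqP; rewrite -mxrank_tr -/(row_free _) -kermx_eq0.
apply/rowV0P => v /sub_kermxP /(congr1 trmx).
rewrite trmx_mul trmxK trmx0 => Av0.
have [//|v0] := eqVneq v 0; case: ncop.
pose x : 'cV[R]_3 := usubmx (v^T : 'cV_(3 + 1)).
pose s : R := dsubmx (v^T : 'cV_(3 + 1)) 0 0.
have vE : v^T = col_mx x s%:M :> 'cV_(3 + 1).
  by rewrite -[LHS](@vsubmxK _ 3 1); congr col_mx; exact: mx11_scalar.
have eqs i : 2 * dot x (a i) = s.
  by apply/subr0_eq; rewrite dotC -matAtE -vE Av0 mxE.
have [x0|x0] := eqVneq x 0; last first.
  by exists x, (s / 2); split=> // i; rewrite -(eqs i) mulrC mulKf ?pnatr_eq0.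
(* If [x = 0], any index would give [s = 0] and hence [v = 0]. So the family is empty and lies in
   every plane. *)
have noI (i : 'I_m) : False.
  move/eqP: v0; apply; apply: trmx_inj; rewrite trmx0 vE x0 -(eqs i) x0.
  by rewrite /dot trmx0 mul0mx mxE mulr0 raddf0 col_mx0.
exists (const_mx 1), 0; split=> [|i]; last by case: (noI i).
by apply/eqP => /colP/(_ 0)/eqP; rewrite !mxE oner_eq0.
Qed.

Lemma u_alphaE : u_alpha a t = col_mx (vecu a t) (alpha a t)%:M.
Proof. by rewrite -[LHS]vsubmxK; congr col_mx; exact: mx11_scalar. Qed.

Lemma v_betaE : v_beta a t = col_mx (vecv a t) (beta a t)%:M.
Proof. by rewrite -[LHS]vsubmxK; congr col_mx; exact: mx11_scalar. Qed.

Hypothesis rkA : (\rank (matA a t) <= 4)%N.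
Hypothesis rkAt : \rank (matAt a) = 4%N.
Hypothesis solvable : exists p, systemS a t p.

Lemma tau_in_span : exists z, 2 *: tau = matAt a *m z.
Proof.
(* The relations of [MS] concern row spaces, so column spaces are compared through transposes. *)
have trA : (((- 2 *: tau)^T + (matAt a)^T)%MS :=: (matA a t)^T)%MS.
  by rewrite matA_row_mx (@tr_row_mx _ _ 1 4); exact: addsmxE.
have sAtA : ((matAt a)^T <= (matA a t)^T)%MS by rewrite -trA addsmxSr.
have sAAt : ((matA a t)^T <= (matAt a)^T)%MS.
  by rewrite -(mxrank_leqif_sup sAtA) eqn_leq mxrankS // !mxrank_tr rkAt.
have : ((- 2 *: tau)^T <= (matAt a)^T)%MS.
  by apply: submx_trans sAAt; rewrite -trA addsmxSl.
case/submxP => z /(congr1 trmx); rewrite trmxK trmx_mul trmxK scaleNr => E.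
by exists (- z^T); rewrite mulmxN -E opprK.
Qed.

Lemma matAt_u : matAt a *m u_alpha a t = 2 *: tau.
Proof.
have [z zE] := tau_in_span.
by rewrite /u_alpha scalemxAr zE -/(lsq_inv _) lsq_invK.
Qed.

Lemma matAt_v : matAt a *m v_beta a t = sqdiff a t.
Proof.
have [z zE] := tau_in_span; have [p /systemS_matAt pE] := solvable.
have wE : sqdiff a t = matAt a *m (lift_pos p - p.1 *: z).
  by rewrite mulmxBr pE -scalemxAr -zE addrK.
by rewrite /v_beta wE -/(lsq_inv _) lsq_invK.
Qed.

Lemma systemS_systemQ p : systemS a t p <-> systemQ a t p.
Proof.
(* [matAt] has a left inverse, so it can be cancelled on both sides. *)
have -> : systemS a t p <-> lift_pos p = v_beta a t + p.1 *: u_alpha a t.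
  rewrite systemS_matAt -matAt_v -matAt_u scalemxAr -mulmxDr.
  by split=> [E|-> //]; rewrite -[LHS](lsq_invK rkAt) E lsq_invK.
rewrite u_alphaE v_betaE scale_col_mx add_col_mx scale_scalar_mx -raddfD /systemQ.
rewrite /quad_coef /lin_coef !sqr_enorm /lift_pos.
have dotx : p.2 = p.1 *: vecu a t + vecv a t ->
    dot p.2 p.2 = p.1 ^+ 2 * dot (vecu a t) (vecu a t)
      + 2 * p.1 * dot (vecu a t) (vecv a t) + dot (vecv a t) (vecv a t).
  move=> ->; rewrite dotDl !dotDr !dotZl !dotZr (dotC (vecv a t)); ring.
split=> [/eq_col_mx[xE sE]|[xE sE]].
  rewrite addrC in xE; split=> //; move: sE => /(congr1 (fun M : 'M_1 => M 0 0)).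
  by rewrite !mxE eqxx !mulr1n (dotx xE); lra.
congr col_mx; first by rewrite addrC.
by congr (_%:M); rewrite (dotx xE); lra.
Qed.

(* If both coefficients vanished, any solution [(t0, x0)] of (S) would give
   [<u, a_i - x0> = t_i - t0], with [|a_i - x0| = |t_i - t0|] and [|u| = 1]: by
   the equality case of Cauchy-Schwarz all [a_i] would lie on the line
   [x0 + R u]. *)
Lemma quad_lin_coef_neq0 :
  ~ coplanar a -> ~ (quad_coef a t = 0 /\ lin_coef a t = 0).
Proof.
have [p pS] := solvable; have [xE _] := (systemS_systemQ p).1 pS.
move=> ncop [/eqP]; rewrite subr_eq0 sqr_enorm => /eqP u1 /subr0_eq uv.
have ua i : dot (vecu a t) (a i - p.2) = t i - p.1.
  move/colP/(_ i): matAt_u; rewrite u_alphaE matAtE !mxE -uv.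
  by rewrite dotBr xE dotDr dotZr u1 (dotC (a i)); lra.
have aE i : a i = (t i - p.1) *: vecu a t + p.2.
  rewrite -(ua i) -cauchy_schwarz_eq ?subrK // ua.
  exact/enorm_eq_norm.
(* The [a i] now lie on a line with direction [u]. A single column has rank at most 1 < 3, so some
   nonzero vector is orthogonal to [u]; it is normal to a plane containing the line. *)
have : kermx (vecu a t) != 0.
  rewrite -mxrank_eq0 mxrank_ker subn_eq0 -ltnNge.
  by rewrite (leq_ltn_trans (rank_leq_col _)).
rewrite -nz_row_eq0 => nu0; apply: ncop.
exists (nz_row (kermx (vecu a t)))^T, (dot (nz_row (kermx (vecu a t)))^T p.2).
split=> [|i]; first by rewrite trmx_eq0.
rewrite aE dotDr dotZr [X in _ * X](_ : _ = 0) ?mulr0 ?add0r //.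
by rewrite /dot trmxK (sub_kermxP (nz_row_sub _)) mxE.
Qed.

End Linearization.

(** * Counting the solutions of (Q) *)

Lemma card_set2 (T : choiceType) (x y : T) : x != y -> [set x; y] #= `I_2.
Proof.
move=> xy; have -> : [set x; y] = [set` [fset x; y]%fset].
  apply/seteqP; split=> z /=; rewrite !inE.
    by case=> ->; rewrite eqxx ?orbT.
  by case/orP=> /eqP; [left|right].
by apply/card_eq_fsetP; rewrite cardfs2 xy.
Qed.

(* Vieta: a second root of [q s^2 + l s + c] is [- l / q - s0]. *)
Lemma quadratic_roots (R : realType) (q l c s0 : R) :
  ~ (q = 0 /\ l = 0) -> q * s0 ^+ 2 + l * s0 + c = 0 ->
  exists s1, forall s, q * s ^+ 2 + l * s + c = 0 <-> s = s0 \/ s = s1.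
Proof.
move=> ql0 r0; have [q0|q0] := eqVneq q 0.
  have l0 : l != 0 by apply/eqP => l0; apply: ql0.
  (* A linear equation has a single root, so [s0] is repeated. *)
  exists s0 => s; split=> [r|[]-> //]; left; apply: (mulfI l0).
  by move: r0 r; rewrite q0; lra.
exists (- l / q - s0) => s.
have -> : q * s ^+ 2 + l * s + c = q * ((s - s0) * (s - (- l / q - s0))).
  by apply/subr0_eq; rewrite -r0; field.
split=> [/eqP|[]->]; last 2 first.
- by rewrite subrr mul0r mulr0.
- by rewrite subrr !mulr0.
by rewrite !mulf_eq0 (negbTE q0) !subr_eq0 /= => /orP[]/eqP; [left|right].
Qed.

Theorem theorem1p1 (R : realType) (m : nat) (a : 'I_m -> 'cV[R]_3)
    (t : 'I_m -> R)
    (hex : exists (x0 : 'cV[R]_3) (t0 : R),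
        forall i, enorm (a i - x0) = t i - t0) :
  (\rank (matA a t) = 5%N ->
     (exists! p : R * 'cV[R]_3, systemS a t p) /\
     (forall p : R * 'cV[R]_3, systemS a t p ->
        (col_mx p.1%:M p.2 : 'cV[R]_(1 + 3)) = matB a t *m sqdiff a t)) /\
  ((\rank (matA a t) <= 4)%N -> ~ coplanar a ->
     (4 <= m)%N /\
     (forall p : R * 'cV[R]_3, systemS a t p <-> systemQ a t p)) /\
  ((\rank (matA a t) <= 4)%N -> ~ coplanar a ->
     ~ (quad_coef a t = 0 /\ lin_coef a t = 0) /\
     ([set p | systemQ a t p] #= `I_1 \/ [set p | systemQ a t p] #= `I_2)).
Proof.
have [p0 p0S] : exists p, systemS a t p.
  (* [t i - t0] equals a norm, so it is its own absolute value. *)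
  case: hex => x0 [t0 h0]; exists (t0, x0) => i.
  by rewrite h0 ger0_norm // -h0 enorm_ge0.
have solvable : exists p, systemS a t p by exists p0.
split=> [rk|].
  split=> [|p]; last exact: matB_mul.
  exists p0; split=> // p pS; move: (matB_mul rk p0S).
  rewrite -(matB_mul rk pS) => /eq_col_mx[/matrixP/(_ 0 0)].
  rewrite !mxE eqxx !mulr1n => e1 e2.
  by case: p0 p e1 e2 {p0S pS} => [? ?] [? ?] /= -> ->.
split=> rkA ncop; have rkAt := matAt_rank ncop.
  split; last exact: systemS_systemQ.
  by rewrite -rkAt rank_leq_row.
have ql0 := quad_lin_coef_neq0 rkA rkAt solvable ncop.
split=> //; have [x0E] := (systemS_systemQ rkA rkAt solvable p0).1 p0S.
rewrite -addrA => /(quadratic_roots ql0)[s1 roots].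
(* A solution of (Q) is determined by its time, a root of the quadratic; one root is the time of
   [p0]. *)
pose pt s := (s, s *: vecu a t + vecv a t).
have -> : [set p | systemQ a t p] = [set pt p0.1; pt s1].
  apply/seteqP; split=> [[s x] []/= ->|p /= pE].
    by rewrite -addrA => /roots[]->; [left|right].
  split; first by case: pE => ->.
  by rewrite -addrA; apply/roots; case: pE => ->; [left|right].
(* The two points coincide for a double root or a linear equation. *)
have [->|neq] := eqVneq (pt p0.1) (pt s1).
  by left; rewrite setUid card_set1.
by right; exact: card_set2.
Qed.
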